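(* Let $G$ be a non-archimedean, Roelcke precompact, Polish group and let $G \curvearrowright X$ be a continuous action on a compact Hausdorff space $X$. Then the simplex of $G$-invariant measures on $X$ is a Bauer simplex, i.e., the set of its extreme points is closed.
   Context: A topological group is non-archimedean if it has a base of open neighbourhoods of the identity consisting of subgroups. A topological group $G$ is Roelcke precompact if for every open neighbourhood $U$ of the identity there is a finite set $E \subseteq G$ with $G = UEU$. ''Measures on $X$'' are regular Borel probability measures; the (possibly empty) convex set of $G$-invariant such measures carries the weak* topology (as a subset of the dual of $C(X)$), and ''closed'' means closed in this set. *)

(* Defs.v *)
From HB Require Import structures.
From mathcomp Require Import all_boot all_order all_algebra.
From mathcomp Require Import all_classical all_reals all_analysis.

Set Implicit Arguments.
Unset Strict Implicit.
Unset Printing Implicit Defensive.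

Import Order.TTheory GRing.Theory Num.Theory.
Import numFieldNormedType.Exports.

Local Open Scope classical_set_scope.
Local Open Scope ring_scope.

HB.mixin Record isTopologicalGroup G & Topological G & Group G := {
  mulg_continuous : continuous (fun p : G * G => (p.1 * p.2)%g) ;
  invg_continuous : continuous (fun x : G => (x^-1)%g)
}.

#[short(type="topologicalGroupType")]
HB.structure Definition TopologicalGroup :=
  {G of Topological G & Group G & isTopologicalGroup G}.

Definition is_subgroup (G : groupType) (H : set G) :=
  [/\ H 1%g,
      forall x y, H x -> H y -> H (x * y)%g
    & forall x, H x -> H (x^-1)%g].

Definition non_archimedean (G : topologicalGroupType) :=
  forall U : set G, nbhs (1%g : G) U ->
    exists H : set G, [/\ open H, is_subgroup H & H `<=` U].

Definition mulset (G : groupType) (A B : set G) : set G :=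
  [set (a * b)%g | a in A & b in B].

Definition roelcke_precompact (G : topologicalGroupType) :=
  forall U : set G, open_nbhs (1%g : G) U ->
    exists2 E : set G, finite_set E & [set: G] = mulset (mulset U E) U.

Definition separable (T : topologicalType) :=
  exists2 D : set T, countable D & dense D.

Definition homeomorphic (S T : topologicalType) :=
  exists (f : S -> T) (g : T -> S),
    [/\ continuous f, continuous g, cancel f g & cancel g f].

(* [completeType] is not used because it bundles a base point. *)
Definition completely_metrizable (R : realType) (T : topologicalType) :=
  exists2 M : metricType R,
    (forall F : set_system M, ProperFilter F -> cauchy F ->
       exists x : M, F --> x)
    & homeomorphic T M.

Definition polish (R : realType) (T : topologicalType) :=
  separable T /\ completely_metrizable R T.

Definition continuous_action (G : topologicalGroupType) (X : topologicalType)
    (act : G -> X -> X) :=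
  [/\ forall x, act 1%g x = x,
      forall g h x, act (g * h)%g x = act g (act h x)
    & continuous (fun p : G * X => act p.1 p.2)].

(* Measurable types are pointed, whence [ptopologicalType]: this only excludes
   the empty space, on which there is no probability measure. *)
Definition borelType (X : ptopologicalType) : measurableType _ :=
  g_sigma_algebraType (@open X).

Section measures.
Context {R : realType} {X : ptopologicalType}.
Implicit Types mu nu : probability (borelType X) R.
Local Open Scope ereal_scope.

Definition regular_measure mu :=
  forall A : set (borelType X), measurable A ->
    mu A = ereal_inf [set mu U | U in [set U : set X | open U /\ A `<=` U]] /\
    mu A = ereal_sup [set mu K | K in [set K : set X | compact K /\ K `<=` A]].

Definition invariant_measure (G : topologicalGroupType) (act : G -> X -> X) mu :=
  forall (g : G) (A : set (borelType X)), measurable A ->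
    mu (act g @^-1` A) = mu A.

(* A [probability] is a function on all subsets, with irrelevant values outside
   the sigma-algebra: equality of measures is equality on Borel sets. *)
Definition borel_eq mu nu :=
  forall A : set (borelType X), measurable A -> mu A = nu A.

Definition extreme_points (K : set (probability (borelType X) R)) :
    set (probability (borelType X) R) :=
  [set mu | K mu /\
     forall nu1 nu2 (t : R), K nu1 -> K nu2 -> (0 < t < 1)%R ->
       (forall A : set (borelType X), measurable A ->
          mu A = t%:E * nu1 A + (1 - t)%:E * nu2 A) ->
       borel_eq nu1 mu /\ borel_eq nu2 mu].

(* The functional on C(X) induced by a measure, C(X)^* carrying the topology of
   pointwise convergence. *)
Definition integral_functional mu : {ptws continuousType X R -> R} :=
  fun f => (\int[mu]_(x in [set: borelType X]) f x)%R.

End measures.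

Definition weak_star (R : realType) (X : ptopologicalType) : topologicalType :=
  initial_topology (@integral_functional R X).

Definition invariant_measures (R : realType) (G : topologicalGroupType)
    (X : ptopologicalType) (act : G -> X -> X) : set (weak_star R X) :=
  [set mu | regular_measure mu /\ invariant_measure act mu].
Arguments invariant_measures R {G X} act.

(* Main.v *)
From HB Require Import structures.
Require Import Defs.
From mathcomp Require Import all_boot all_order all_algebra.
From mathcomp Require Import all_classical all_reals all_analysis.
From mathcomp Require Import measurable_realfun ring lra.

Set Implicit Arguments.
Unset Strict Implicit.
Unset Printing Implicit Defensive.

(** The proof replaces extremality by a property that only speaks of continuous
    functions and therefore survives weak* limits: an invariant measure [nu]
    averages to constants if every continuous [f] has convex combinations of
    its translates [f \o act g] arbitrarily close in L2([nu]) to the constant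
    [\int f dnu].

    Extreme measures average to constants ([extreme_averages]). Take almost
    shortest elements [k_n] of the convex hull of the orbit of [f]. By the
    parallelogram identity they form a Cauchy sequence in L2 and are almost
    invariant, so the signed measures [k_n dnu] converge on every Borel set to
    an invariant signed measure dominated by a multiple of [nu]. Moving [nu] a
    little along this limit, recentred to total mass 0, in both directions
    exhibits [nu] as a midpoint; by extremality the recentred limit is 0
    ([extreme_rigid]), and since the convergence is uniform over Borel sets,
    [k_n] tends to a constant. This bypasses the completeness of L2.

    Conversely an invariant regular [mu] that averages to constants is extreme
    ([averaging_extreme]): if [mu] is a proper convex combination of [nu1] and
    [nu2], then [nu1] is dominated by a multiple of [mu], so averages that are
    nearly constant for [mu] are nearly constant for [nu1], whence [nu1] and
    [mu] have the same integrals of continuous functions.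

    Roelcke precompactness enters in [averages_limit]. Let [mu] be a limit of
    invariant measures that average to constants, and let [k] be almost shortest
    in the hull of the orbit of [f] in L2([mu]); all its translates are close to
    it in L2([mu]). Some neighbourhood [V] of 1 moves [k] by little in sup norm,
    and [G = V A V] with [A] finite, so in L2 of any invariant measure the
    displacement of [k] by an arbitrary [g] is controlled by the displacements
    by elements of [A] ([displacement_double_coset]). These are finitely many
    weak* continuous quantities, hence still small for some nearby [nu] which
    averages to constants. Every average of [k] is then close to [k] in
    L2([nu]), and one of them is close to a constant; so [k] is close to a
    constant in L2([nu]), and again by weak* continuity in L2([mu]). *)

Import Order.TTheory GRing.Theory Num.Theory.
Import numFieldNormedType.Exports.

Local Open Scope classical_set_scope.
Local Open Scope ring_scope.

(** * Bounded measurable functions under a probability *)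

Section bounded_measurable.
Context d (T : measurableType d) (R : realType).
Implicit Types (f g : T -> R) (mu nu : probability T R).

(** Everything below is integrated against a probability, so boundedness is a
    convenient substitute for integrability that is stable under products. *)
Definition bmeas f :=
  measurable_fun [set: T] f /\ exists M : R, forall x, `|f x| <= M.

Lemma bmeas_cst (c : R) : bmeas (fun=> c).
Proof. by split; [exact: measurable_cst | exists `|c|]. Qed.

Lemma bmeasD f g : bmeas f -> bmeas g -> bmeas (fun x => f x + g x).
Proof.
move=> [mf [M fM]] [mg [N gN]]; split; first exact: measurable_funD.
by exists (M + N) => x; rewrite (le_trans (ler_normD _ _))// lerD.
Qed.

Lemma bmeasN f : bmeas f -> bmeas (fun x => - f x).
Proof.
move=> [mf [M fM]]; split; last by exists M => x; rewrite normrN.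
exact: measurableT_comp.
Qed.

Lemma bmeasB f g : bmeas f -> bmeas g -> bmeas (fun x => f x - g x).
Proof. by move=> bf bg; apply: bmeasD => //; exact: bmeasN. Qed.

Lemma bmeasM f g : bmeas f -> bmeas g -> bmeas (fun x => f x * g x).
Proof.
move=> [mf [M fM]] [mg [N gN]]; split; first exact: measurable_funM.
by exists (M * N) => x; rewrite normrM ler_pM.
Qed.

Lemma bmeasX2 f : bmeas f -> bmeas (fun x => f x ^+ 2).
Proof. exact: (fun bf => bmeasM bf bf). Qed.

Lemma bmeas_indic (A : set T) : measurable A -> bmeas (\1_A : T -> R).
Proof.
move=> mA; split; first exact: measurable_indic.
exists 1 => x; rewrite indicE; case: (_ \in _); by rewrite ?normr1 ?normr0.
Qed.

Lemma bmeas_integrable mu f : bmeas f -> mu.-integrable [set: T] (EFin \o f).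
Proof.
move=> [mf [M fM]]; apply: measurable_bounded_integrable => //.
  by apply: le_lt_trans (probability_le1 mu _) _; rewrite ?ltry.
exists M; split; first exact: num_real.
by move=> x Mx t _; exact: le_trans (fM t) (ltW Mx).
Qed.

Local Notation E mu f := (Rintegral mu [set: T] f).

Lemma expect_cst mu (c : R) : E mu (fun=> c) = c.
Proof. by rewrite Rintegral_cst// [X in fine X](probability_setT mu) mulr1. Qed.

Lemma expectD mu f g : bmeas f -> bmeas g ->
  E mu (fun x => f x + g x) = E mu f + E mu g.
Proof. by move=> bf bg; apply: RintegralD => //; exact: bmeas_integrable. Qed.

Lemma expectB mu f g : bmeas f -> bmeas g ->
  E mu (fun x => f x - g x) = E mu f - E mu g.
Proof. by move=> bf bg; apply: RintegralB => //; exact: bmeas_integrable. Qed.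

Lemma expectZ mu (r : R) f : bmeas f -> E mu (fun x => r * f x) = r * E mu f.
Proof. by move=> bf; apply: RintegralZl => //; exact: bmeas_integrable. Qed.

Lemma le_expect mu f g : bmeas f -> bmeas g -> (forall x, f x <= g x) ->
  E mu f <= E mu g.
Proof.
by move=> bf bg fg; apply: le_Rintegral => //; exact: bmeas_integrable.
Qed.

Lemma expect_ge0 mu f : (forall x, 0 <= f x) -> 0 <= E mu f.
Proof. by move=> f0; exact: Rintegral_ge0. Qed.

Lemma expect_indic mu (A : set T) : measurable A -> E mu \1_A = fine (mu A).
Proof. by move=> mA; rewrite /Rintegral integral_indic// setIT. Qed.

End bounded_measurable.

(** Side conditions [bmeas _] for polynomial expressions. *)
Ltac bm := repeat first [ assumption | apply: bmeasX2 | apply: bmeasB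
  | apply: bmeasD | apply: bmeasN | apply: bmeasM | apply: bmeas_cst
  | apply: bmeas_indic ].

Section jensen.
Context d (T : measurableType d) (R : realType).
Implicit Types (f g : T -> R) (mu nu : probability T R).
Local Notation E mu f := (Rintegral mu [set: T] f).

(** The variance is nonnegative. *)
Lemma expect_sqr mu f : bmeas f -> (E mu f) ^+ 2 <= E mu (fun x => f x ^+ 2).
Proof.
move=> bf; rewrite -subr_ge0.
have := @expect_ge0 _ _ _ mu (fun x => (f x - E mu f) ^+ 2)
  (fun x => sqr_ge0 _).
rewrite (_ : (fun x => _) =
    (fun x => f x ^+ 2 - (2 * E mu f * f x - E mu f ^+ 2))).
  rewrite expectB; [|by bm..].
  rewrite expectB; [|by bm..].
  rewrite expectZ// expect_cst; lra.
by apply/funext => x; ring.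
Qed.

End jensen.

(** * Continuous functions and translation on a compact space *)

Section continuous_functions.
Context (R : realType) (X : ptopologicalType).
Implicit Types f : X -> R.

Lemma continuous_measurable_borel f : continuous f ->
  measurable_fun [set: borelType X] (f : borelType X -> R).
Proof.
move=> cf; apply: (measurability _ (RGenOInfty.measurableE R)).
move=> _ [_ [a ->] <-]; rewrite setTI; apply: sub_sigma_algebra.
by move/continuousP : cf; apply; exact: interval_open.
Qed.

Lemma continuous_bmeas f : compact [set: X] -> continuous f ->
  bmeas (f : borelType X -> R).
Proof.
move=> cX cf; split; first exact: continuous_measurable_borel.
have /compact_bounded [M [_ fM]] : compact (f @` [set: X]).
  by apply: continuous_compact => //; exact: continuous_subspaceT.
exists (M + 1) => x; apply: (fM (M + 1)); first by rewrite ltrDl.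
by exists x.
Qed.

Lemma continuous_self_measurable (u : X -> X) : continuous u ->
  measurable_fun [set: borelType X] (u : borelType X -> borelType X).
Proof.
move=> cu.
apply: (@measurability _ _ (borelType X) (borelType X) _ u (@open X)).
  by [].
move=> _ [B oB <-]; rewrite setTI; apply: sub_sigma_algebra.
by move/continuousP : cu; apply.
Qed.

End continuous_functions.

Section translation.
Context (R : realType) (G : topologicalGroupType) (X : ptopologicalType).
Context (act : G -> X -> X).
Hypothesis actP : continuous_action act.
Implicit Types (f k l : X -> R) (mu nu : probability (borelType X) R).

Lemma action_continuous g : continuous (act g).
Proof.
case: actP => _ _ ca x.
apply: (@continuous_comp _ _ _ (fun y => (g, y))
  (fun p : G * X => act p.1 p.2)).
  by apply: cvg_pair; [exact: cvg_cst | exact: cvg_id].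
exact: ca.
Qed.

Lemma bmeas_act (f : borelType X -> R) g : bmeas f ->
  bmeas (f \o act g : borelType X -> R).
Proof.
move=> [mf [M fM]]; split; last by exists M => x /=.
apply: measurableT_comp => //.
by apply: continuous_self_measurable; exact: action_continuous.
Qed.

Lemma expect_act mu (f : borelType X -> R) g : invariant_measure act mu ->
  bmeas f -> Rintegral mu setT (f \o act g) = Rintegral mu setT f.
Proof.
move=> imu bf.
have ma : measurable_fun setT (act g : borelType X -> borelType X).
  by apply: continuous_self_measurable; exact: action_continuous.
congr fine; have := @integral_pushforward _ _ _ _ R _ ma mu setT (EFin \o f).
rewrite preimage_setT => <- //.
- by apply: eq_measure_integral => A mA _; exact: imu.
- by apply/measurable_EFinP; case: bf.
- by apply: bmeas_integrable; exact: bmeas_act.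
Qed.

End translation.

(** The dyadic convex hull of the orbit of [f]: midpoints are all that the
    parallelogram identity asks for, and an inductive presentation turns every
    property of averages into an induction. *)
Inductive orbit_hull (R : realType) (G X : Type) (act : G -> X -> X)
    (f : X -> R) : (X -> R) -> Prop :=
| orbit_hull_id : orbit_hull act f f
| orbit_hull_act k g : orbit_hull act f k -> orbit_hull act f (k \o act g)
| orbit_hull_mid k l : orbit_hull act f k -> orbit_hull act f l ->
    orbit_hull act f (fun x => (k x + l x) / 2).

Section hull.
Context (R : realType) (G : topologicalGroupType) (X : ptopologicalType).
Context (act : G -> X -> X).
Hypothesis (cX : compact [set: X]) (actP : continuous_action act).
Implicit Types (f k l : X -> R) (mu nu : probability (borelType X) R).
Local Notation E mu f := (Rintegral mu [set: borelType X] f).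
Local Notation hull := (orbit_hull act).

Lemma orbit_hull_bounded f (M : R) k : (forall x, `|f x| <= M) -> hull f k ->
  forall x, `|k x| <= M.
Proof.
move=> fM; elim=> // [l g _ h x|l1 l2 _ h1 _ h2 x]; first exact: h.
by have := h1 x; have := h2 x; rewrite !ler_norml; lra.
Qed.

Lemma orbit_hull_continuous f k : continuous f -> hull f k -> continuous k.
Proof.
move=> cf; elim=> // [l g _ cl x|l1 l2 _ c1 _ c2 x].
  by apply: continuous_comp; [exact: action_continuous | exact: cl].
by apply: cvgMl; apply: cvgD; [exact: c1 | exact: c2].
Qed.

Lemma orbit_hull_bmeas f k : continuous f -> hull f k ->
  bmeas (k : borelType X -> R).
Proof.
by move=> cf fk; apply: continuous_bmeas => //; exact: orbit_hull_continuous fk.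
Qed.

Lemma orbit_hull_expect mu f k : invariant_measure act mu -> continuous f ->
  hull f k -> E mu k = E mu f.
Proof.
move=> imu cf; elim=> // [l g fl <-|l1 l2 fl1 e1 fl2 e2].
  by rewrite expect_act//; exact: orbit_hull_bmeas fl.
have b1 := orbit_hull_bmeas cf fl1; have b2 := orbit_hull_bmeas cf fl2.
rewrite (_ : (fun x => _) = (fun x => 2^-1 * (l1 x + l2 x))); last first.
  by apply/funext => x; rewrite mulrC.
by rewrite expectZ ?expectD//; [rewrite e1 e2; lra | bm].
Qed.

(** A ball around [f] in L2 is convex, so an orbit of small diameter stays small
    after averaging. *)
Lemma orbit_hull_dist mu f (e : R) k : continuous f ->
  (forall g, E mu (fun x => (f (act g x) - f x) ^+ 2) <= e) -> hull f k ->
  E mu (fun x => (k x - f x) ^+ 2) <= e.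
Proof.
move=> cf fe fk.
suff /(_ 1%g) : forall g, E mu (fun x => (k (act g x) - f x) ^+ 2) <= e.
  by case: actP => a1 _ _; under eq_Rintegral do rewrite a1.
have bf : bmeas (f : borelType X -> R) by exact: continuous_bmeas.
elim: fk => // [l h fl ih g|l1 l2 fl1 ih1 fl2 ih2 g].
  have := ih (h * g)%g; case: actP => _ aM _.
  by under eq_Rintegral do rewrite aM.
have b1 : bmeas (fun x : borelType X => l1 (act g x)).
  by apply: (bmeas_act actP g); exact: orbit_hull_bmeas fl1.
have b2 : bmeas (fun x : borelType X => l2 (act g x)).
  by apply: (bmeas_act actP g); exact: orbit_hull_bmeas fl2.
have := ih1 g; have := ih2 g => i2 i1.
apply: (@le_trans _ _ (E mu (fun x => 2^-1 * (l1 (act g x) - f x) ^+ 2 +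
                                  2^-1 * (l2 (act g x) - f x) ^+ 2))).
  apply: le_expect => [||x]; [by bm|by bm|].
  set a := l1 _; set b := l2 _; have := sqr_ge0 (a - b); nra.
rewrite expectD; [|by bm..].
rewrite !expectZ; [|by bm..].
lra.
Qed.

(** The squared L2 distance from the origin to the hull. *)
Definition min_square mu f : R :=
  inf [set E mu (fun x => k x ^+ 2) | k in hull f].

Lemma min_square_le mu f k : hull f k ->
  min_square mu f <= E mu (fun x => k x ^+ 2).
Proof.
move=> fk; apply: ge_inf; last by exists k.
by exists 0 => _ [l _ <-]; apply: expect_ge0 => x; exact: sqr_ge0.
Qed.

Lemma min_square_approx mu f (e : R) : 0 < e -> exists2 k, hull f k &
  E mu (fun x => k x ^+ 2) <= min_square mu f + e.
Proof.
move=> e0; have [|_ [k fk <-] ke] := @inf_adherent _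
  [set E mu (fun x => k x ^+ 2) | k in hull f] _ e0.
  split.
    by exists (E mu (fun x => f x ^+ 2)); exists f => //; exact: orbit_hull_id.
  by exists 0 => _ [l _ <-]; apply: expect_ge0 => x; exact: sqr_ge0.
by exists k => //; exact: ltW.
Qed.

(** The parallelogram identity: the midpoint of two almost minimal elements is
    again in the hull, hence not shorter than the minimum. *)
Lemma min_square_dist mu f k l (a b : R) :
  continuous f -> hull f k -> hull f l ->
  E mu (fun x => k x ^+ 2) <= min_square mu f + a ->
  E mu (fun x => l x ^+ 2) <= min_square mu f + b ->
  E mu (fun x => (k x - l x) ^+ 2) <= 2 * a + 2 * b.
Proof.
move=> cf fk fl ka lb.
have bk := orbit_hull_bmeas cf fk; have bl := orbit_hull_bmeas cf fl.
have := min_square_le mu (orbit_hull_mid fk fl).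
rewrite (_ : (fun x => (k x - l x) ^+ 2) =
    (fun x => (2 * k x ^+ 2 + 2 * l x ^+ 2) - 4 * ((k x + l x) / 2) ^+ 2));
  last by apply/funext => x; field.
rewrite expectB; [|by bm..].
rewrite expectD; [|by bm..].
rewrite !expectZ; [|by bm..].
lra.
Qed.

(** A translate of an almost minimal element is almost minimal, hence close to
    that element: this is where almost invariant averages come from. *)
Lemma min_square_shift mu f k (a : R) g : invariant_measure act mu ->
  continuous f -> hull f k -> E mu (fun x => k x ^+ 2) <= min_square mu f + a ->
  E mu (fun x => (k (act g x) - k x) ^+ 2) <= 4 * a.
Proof.
move=> imu cf fk ka; have bk := orbit_hull_bmeas cf fk.
rewrite (_ : 4 * a = 2 * a + 2 * a); last by ring.
apply: (min_square_dist cf (orbit_hull_act g fk) fk) => //.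
by have /= -> := expect_act actP g imu (bmeasX2 bk).
Qed.

End hull.

(** * Regular measures and integrals of continuous functions *)

Section convex_expectation.
Context d (T : measurableType d) (R : realType).
Implicit Types (f : T -> R) (mu nu : probability T R).
Local Notation E mu f := (Rintegral mu [set: T] f).

Lemma expect_convex mu nu1 nu2 (t : R) f : 0 < t < 1 ->
  (forall A, measurable A ->
    mu A = (t%:E * nu1 A + (1 - t)%:E * nu2 A)%E) ->
  bmeas f -> (forall x, 0 <= f x) ->
  E mu f = t * E nu1 f + (1 - t) * E nu2 f.
Proof.
move=> /andP[t0 t1] muE bf f0.
have t'0 : 0 <= 1 - t by lra.
pose m := measure_add (mscale (NngNum (ltW t0)) nu1) (mscale (NngNum t'0) nu2).
have mf : measurable_fun [set: T] (EFin \o f).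
  by apply/measurable_EFinP; case: bf.
have ff nu : (\int[nu]_x (f x)%:E)%E \is a fin_num.
  by apply: integrable_fin_num => //; exact: bmeas_integrable.
have f0' x : [set: T] x -> (0 <= (f x)%:E)%E by rewrite lee_fin.
rewrite /Rintegral (eq_measure_integral m); last first.
  by move=> A mA _; rewrite [RHS](measure_addE _ _ A); exact: muE.
rewrite /m ge0_integral_measure_add// !ge0_integral_mscale//.
rewrite fineD ?fin_numM ?ff//. rewrite !fineM ?ff//.
Qed.

End convex_expectation.

Section regularity.
Context (R : realType) (X : ptopologicalType).
Hypothesis (cX : compact [set: X]) (hX : hausdorff_space X).
Implicit Types mu nu : probability (borelType X) R.
Local Notation E mu f := (Rintegral mu [set: borelType X] f).

Lemma open_measurable_borel (U : set X) : open U ->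
  measurable (U : set (borelType X)).
Proof. exact: sub_sigma_algebra. Qed.

Lemma compact_measurable_borel (K : set X) : compact K ->
  measurable (K : set (borelType X)).
Proof.
move=> /(compact_closed hX)/closed_openC/open_measurable_borel mK.
by rewrite -(setCK K); exact: measurableC.
Qed.

(** Integrate an Urysohn function that separates [K] from the complement of
    [U]. *)
Lemma le_compact_open mu nu (K U : set X) :
  (forall f : X -> R, continuous f -> E mu f = E nu f) ->
  compact K -> open U -> K `<=` U -> (mu K <= nu U)%E.
Proof.
move=> mn cK oU KU.
have mK := compact_measurable_borel cK.
have mU := open_measurable_borel oU.
have UK0 : ~` U `&` K = set0 by apply/seteqP; split => // x [nUx /KU].
move/normal_separatorP : (compact_normal hX cX) => sepX.
have := sepX R _ _ (open_closedC oU) (compact_closed hX cK) UK0.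
move=> /(@uniform_separatorP _ R)[f [cf f01 f0 f1]].
have bf := continuous_bmeas cX cf.
have fge0 x : 0 <= f x <= 1.
  by have := f01 (f x) (ex_intro2 _ _ x I erefl); rewrite /= in_itv.
rewrite -(@fineK _ (mu K)) ?fin_num_measure//.
rewrite -(@fineK _ (nu U)) ?fin_num_measure//.
rewrite lee_fin -!expect_indic//.
apply: (@le_trans _ _ (E mu f)); last rewrite mn//.
  apply: le_expect => [||x]; [by bm|by bm|rewrite indicE].
  case: (boolP (x \in K)) => [/set_mem Kx|_] /=; last by have /andP[] := fge0 x.
  by rewrite (f1 (f x)) => //; exists x.
apply: le_expect => [||x]; [by bm|by bm|rewrite indicE].
case: (boolP (x \in U)) => [_|/negP nUx] /=; first by have /andP[] := fge0 x.
by rewrite (f0 (f x)) => //; exists x => // Ux; apply: nUx; exact: mem_set.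
Qed.

(** Regularity makes integrals of continuous functions separate measures. *)
Lemma regular_borel_eq mu nu : regular_measure mu -> regular_measure nu ->
  (forall f : X -> R, continuous f -> E mu f = E nu f) -> borel_eq mu nu.
Proof.
move=> rmu rnu mn A mA.
suff le m1 m2 : regular_measure m1 -> regular_measure m2 ->
    (forall f : X -> R, continuous f -> E m1 f = E m2 f) -> (m1 A <= m2 A)%E.
  by apply/eqP; rewrite eq_le !le// => f cf; rewrite mn.
move=> r1 r2 m12; rewrite (r1 A mA).2; apply: ge_ereal_sup => _ [K [cK KA] <-].
have mK := compact_measurable_borel cK.
apply: (@le_trans _ _ (m2 K)); last by rewrite le_measure ?inE.
rewrite (r2 K mK).1; apply: le_ereal_inf_tmp => _ [U [oU KU] <-].
exact: le_compact_open.
Qed.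

End regularity.

Section averages.
Context (R : realType) (G : topologicalGroupType) (X : ptopologicalType).
Context (act : G -> X -> X).
Hypothesis (cX : compact [set: X]) (hX : hausdorff_space X).
Hypothesis (actP : continuous_action act).
Implicit Types (f k l : X -> R) (mu nu : probability (borelType X) R).
Local Notation E mu f := (Rintegral mu [set: borelType X] f).
Local Notation hull := (orbit_hull act).

(** For invariant regular measures this is a form of ergodicity that
    mentions continuous functions only. *)
Definition averages_to_constants mu := forall f, continuous f ->
  forall e : R, 0 < e -> exists2 k, hull f k &
    E mu (fun x => (k x - E mu f) ^+ 2) <= e.

(** A component [nu] of [mu] with weight [s] satisfies [nu <= mu / s]; the
    integral of [f] against [nu], being that of every average of [f], is
    therefore the constant to which those averages tend in L2([mu]). *)
Lemma averaging_extreme mu : invariant_measures R act mu ->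
  averages_to_constants mu -> extreme_points (invariant_measures R act) mu.
Proof.
move=> [rmu imu] amu; split=> // nu1 nu2 t [r1 i1] [r2 i2] t01 muE.
suff main (s : R) nu nu' : 0 < s < 1 -> invariant_measure act nu ->
    regular_measure nu ->
    (forall A : set (borelType X), measurable A ->
       mu A = (s%:E * nu A + (1 - s)%:E * nu' A)%E) -> borel_eq nu mu.
  split; first exact: (main t _ nu2).
  apply: (main (1 - t) _ nu1) => //; first by lra.
  by move=> A mA; rewrite muE// addeC subKr.
move=> s01 inu rnu {}muE; apply: (regular_borel_eq cX hX) => // f cf.
have /andP[s0 s1] := s01.
apply/eqP; rewrite -subr_eq0 -sqrf_eq0 eq_le sqr_ge0 andbT.
apply/ler_addgt0Pr => e e0; rewrite add0r.
have [k fk ke] := amu f cf (s * e) (mulr_gt0 s0 e0).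
have bk := orbit_hull_bmeas cX actP cf fk.
rewrite -(orbit_hull_expect cX actP inu cf fk).
rewrite (_ : _ - _ = E nu (fun x => k x - E mu f)); last first.
  by rewrite expectB ?expect_cst//; exact: bmeas_cst.
apply: le_trans (expect_sqr _ _) _; first by bm.
rewrite -(ler_pM2l s0); apply: le_trans ke.
rewrite [leRHS](expect_convex s01 muE); [|by bm|by move=> x; exact: sqr_ge0].
by rewrite lerDl mulr_ge0 ?expect_ge0//; [lra | move=> x; exact: sqr_ge0].
Qed.

End averages.

(** * Perturbations of an extreme measure *)

Section build_probability.
Context d (T : measurableType d) (R : realType).
Local Open Scope ereal_scope.

Lemma exists_probability (m : set T -> \bar R) : m set0 = 0 ->
  (forall A, 0 <= m A) -> semi_sigma_additive m -> m setT = 1 ->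
  exists P : probability T R, forall A, P A = m A.
Proof.
move=> m0 mge0 msa m1.
pose mM := isMeasure.Build _ _ _ m m0 mge0 msa.
pose m' : {measure set T -> \bar R} := HB.pack m mM.
pose mP := Measure_isProbability.Build _ _ _ m' m1.
pose P : probability T R := HB.pack m mM mP.
by exists P.
Qed.

End build_probability.

Section perturbation.
Context d (T : measurableType d) (R : realType) (nu : probability T R).
Variable eta : set T -> R.
Hypothesis eta_add : forall A B, measurable A -> measurable B ->
  A `&` B = set0 -> eta (A `|` B) = eta A + eta B.
Hypothesis eta_le : forall A, measurable A -> `|eta A| <= fine (nu A).
Hypothesis eta_setT : eta setT = 0.

Let r A := fine (nu A).

Let r_add A B : measurable A -> measurable B ->
  A `&` B = set0 -> r (A `|` B) = r A + r B.
Proof. by move=> mA mB AB; rewrite /r measureU// fineD ?fin_num_measure. Qed.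

(** A finitely additive perturbation dominated by [nu] is automatically
    countably additive: the tails are controlled by those of [nu]. Outside the
    sigma-algebra the truncation at 0 merely keeps the set function
    nonnegative. *)
Lemma perturbed_probability : exists P : probability T R,
  forall A, measurable A -> P A = (fine (nu A) + eta A)%:E.
Proof.
pose q A := r A + eta A.
have q_add A B : measurable A -> measurable B -> A `&` B = set0 ->
    q (A `|` B) = q A + q B.
  by move=> mA mB AB; rewrite /q r_add// eta_add//; ring.
have q_bnd A : measurable A -> 0 <= q A <= 2 * r A.
  by move=> mA; have := eta_le mA; rewrite -/(r A) ler_norml /q; lra.
pose m A := (Num.max 0 (q A))%:E.
have mE A : measurable A -> m A = (q A)%:E.
  by move=> mA; rewrite /m max_r//; have /andP[] := q_bnd _ mA.
have q0 : q set0 = 0.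
  have := q_add _ _ (@measurable0 _ T) (@measurable0 _ T) (setI0 _).
  rewrite setU0; lra.
have [||||P PE] := @exists_probability _ _ R m.
- by rewrite mE// q0.
- by move=> A; rewrite lee_fin le_max lexx.
- move=> F mF tF mUF.
  pose B n := \big[setU/set0]_(i < n) F i.
  have mB n : measurable (B n) by exact: bigsetU_measurable.
  have sumE n : (\sum_(0 <= i < n) m (F i) = (q (B n))%:E)%E.
    elim: n => [|n ih]; first by rewrite big_geq// /B big_ord0 q0.
    rewrite big_nat_recr//= ih mE// -EFinD -q_add//.
      by rewrite /B big_ord_recr.
    by apply: (@trivIset_bigsetUI _ predT) => //; exact: sub_trivIset tF.
  pose U := \bigcup_n F n.
  have BU n : B n `<=` U.
    by move=> x; rewrite /B -bigcup_mkord => -[i _ Fx]; exists i.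
  have mD n : measurable (U `\` B n) by exact: measurableD.
  have UE n : U = B n `|` (U `\` B n) by rewrite setDUK.
  have BD0 n : B n `&` (U `\` B n) = set0 by rewrite setDE setICA setICr setI0.
  have rB : r (B n) @[n --> \oo] --> r U.
    apply: fine_cvg; rewrite fineK ?fin_num_measure//.
    have <- : \bigcup_n B n = U.
      apply/seteqP; split => [x [n _ /BU]//|x [n _ Fx]].
      by exists n.+1 => //; rewrite /B big_ord_recr /=; right.
    apply: nondecreasing_cvg_mu => //; first exact: bigcup_measurable.
    by move=> i j ij; apply/subsetPset; exact: subset_bigsetU.
  rewrite mE//; under eq_fun do rewrite sumE.
  apply/fine_cvgP; split; first exact: nearW.
  apply: (@squeeze_cvgr _ _ _ _
    (fun n => q U - 2 * (r U - r (B n))) (fun=> q U)).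
  - apply: nearW => n /=; have := q_bnd _ (mD n).
    by rewrite [in q U](UE n) [in r U](UE n) q_add// r_add//; lra.
  - rewrite -[X in _ --> X]subr0 -(mulr0 2) -(subrr (r U)).
    apply: cvgB; first exact: cvg_cst.
    by apply: cvgMr; apply: cvgB => //; exact: cvg_cst.
  - exact: cvg_cst.
- rewrite mE// /q /r eta_setT addr0; congr EFin.
  by rewrite [X in fine X](probability_setT nu).
by exists P => A mA; rewrite PE mE.
Qed.

End perturbation.

Section fine_measure.
Context d (T : measurableType d) (R : realType) (mu : probability T R).

Lemma fine_measureD A B : measurable A -> measurable B -> A `<=` B ->
  fine (mu (B `\` A)) = fine (mu B) - fine (mu A).
Proof.
move=> mA mB AB; have mD := measurableD mB mA.
have -> : mu B = (mu A + mu (B `\` A))%E.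
  rewrite -measureU//; last by rewrite setDE setICA setICr setI0.
  by rewrite setDUK.
by rewrite fineD ?fin_num_measure// addrC addKr.
Qed.

End fine_measure.

Section extreme.
Context (R : realType) (X : ptopologicalType).
Hypothesis hX : hausdorff_space X.
Implicit Types mu nu rho : probability (borelType X) R.

(** Approximating [A] for [nu] within [e / M] approximates it for [rho] within
    [e]. *)
Lemma regular_dominated nu rho (M : R) : 0 < M -> regular_measure nu ->
  (forall A : set (borelType X), measurable A ->
    fine (rho A) <= M * fine (nu A)) -> regular_measure rho.
Proof.
move=> M0 rnu rn A mA; have [infA supA] := rnu A mA.
have fA : nu A \is a fin_num by rewrite fin_num_measure.
split; apply/eqP; rewrite eq_le; apply/andP; split.
- apply: le_ereal_inf_tmp => _ [U [oU AU] <-].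
  by rewrite le_measure ?inE//; exact: open_measurable_borel.
- apply/lee_addgt0Pr => e e0.
  have [|_ [U [oU AU] <-]] := @lb_ereal_inf_adherent R
    [set nu U | U in [set U : set X | open U /\ A `<=` U]] (e / M)
    (divr_gt0 e0 M0).
    by rewrite -infA.
  have mU := open_measurable_borel oU.
  rewrite -infA -{1}(fineK fA) -(fineK (fin_num_measure nu _ mU)).
  rewrite -EFinD lte_fin => Ue.
  apply: (@le_trans _ _ (rho U)); first by apply: ereal_inf_lbound; exists U.
  rewrite -(fineK (fin_num_measure rho _ mU)).
  rewrite -(fineK (fin_num_measure rho _ mA)).
  rewrite -EFinD lee_fin; have := rn _ (measurableD mU mA).
  rewrite !fine_measureD// => rUA.
  have : M * (fine (nu U) - fine (nu A)) <= M * (e / M).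
    by rewrite ler_pM2l//; lra.
  by rewrite mulrCA divff ?gt_eqF// mulr1; lra.
- apply/lee_addgt0Pr => e e0.
  have [|_ [K [cK KA] <-]] := @ub_ereal_sup_adherent R
    [set nu K | K in [set K : set X | compact K /\ K `<=` A]] (e / M)
    (divr_gt0 e0 M0).
    by rewrite -supA.
  have mK := compact_measurable_borel hX cK.
  rewrite -supA -{1}(fineK fA) -(fineK (fin_num_measure nu _ mK)).
  rewrite -EFinB lte_fin => Ke.
  apply: (@le_trans _ _ (rho K + e%:E)%E); last first.
    by rewrite leeD2r//; apply: ereal_sup_ubound; exists K.
  rewrite -(fineK (fin_num_measure rho _ mK)).
  rewrite -(fineK (fin_num_measure rho _ mA)).
  rewrite -EFinD lee_fin; have := rn _ (measurableD mA mK).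
  rewrite !fine_measureD// => rUA.
  have : M * (fine (nu A) - fine (nu K)) <= M * (e / M).
    by rewrite ler_pM2l//; lra.
  by rewrite mulrCA divff ?gt_eqF// mulr1; lra.
- apply: ge_ereal_sup => _ [K [cK KA] <-].
  by rewrite le_measure ?inE//; exact: compact_measurable_borel.
Qed.

Context (G : topologicalGroupType) (act : G -> X -> X).
Hypothesis actP : continuous_action act.

(** [nu] is the midpoint of its two perturbations by [eta] and [- eta]. *)
Lemma extreme_rigid nu (eta : set (borelType X) -> R) :
  extreme_points (invariant_measures R act) nu ->
  (forall A B : set (borelType X), measurable A -> measurable B ->
     A `&` B = set0 ->
     eta (A `|` B) = eta A + eta B) ->
  (forall A : set (borelType X), measurable A -> `|eta A| <= fine (nu A)) ->
  eta setT = 0 ->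
  (forall g (A : set (borelType X)), measurable A ->
     eta (act g @^-1` A) = eta A) ->
  forall A : set (borelType X), measurable A -> eta A = 0.
Proof.
move=> [[rnu inu] ext] etaD etale etaT etaI A mA.
have pert (s : R) : `|s| = 1 -> exists2 P : probability (borelType X) R,
    invariant_measures R act P &
    forall A : set (borelType X), measurable A ->
      P A = (fine (nu A) + s * eta A)%:E.
  move=> s1.
  have [|||P PE] := @perturbed_probability _ _ R nu (fun A => s * eta A).
  - by move=> B C mB mC BC; rewrite etaD// mulrDr.
  - by move=> B mB; rewrite normrM s1 mul1r etale.
  - by rewrite etaT mulr0.
  exists P => //; split.
    apply: (@regular_dominated nu P 2) => // B mB; rewrite PE//=.
    have : `|s * eta B| <= fine (nu B) by rewrite normrM s1 mul1r etale.
    by rewrite ler_norml; lra.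
  move=> g B mB.
  have mgB : measurable (act g @^-1` B : set (borelType X)).
    rewrite -[X in measurable X]setTI; apply: continuous_self_measurable => //.
    exact: action_continuous.
  by rewrite !PE// etaI// inu.
have [P1 K1 P1E] := pert 1 (normr1 _).
have [P2 K2 P2E] := pert (-1) (etrans (normrN _) (normr1 _)).
have half01 : 0 < (2^-1 : R) < 1 by lra.
have [|P1nu _] := ext P1 P2 2^-1 K1 K2 half01.
  move=> B mB; rewrite P1E// P2E// -!EFinM -EFinD.
  rewrite -[LHS]fineK ?fin_num_measure//.
  by congr EFin; lra.
have := P1nu A mA; rewrite P1E// -[RHS]fineK ?fin_num_measure//.
by move=> [] ; lra.
Qed.

End extreme.

(** * Averages under an extreme measure *)

Section real_sequences.
Context (R : realType).
Implicit Types u e : nat -> R.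

Lemma cvg_of_sqr_dist u e : (forall n p, (u n - u p) ^+ 2 <= e n + e p) ->
  e n @[n --> \oo] --> (0 : R) -> cvg (u n @[n --> \oo]).
Proof.
move=> ue e0; apply: cauchy_cvg; apply: cauchy_exP => d d0.
have d20 : 0 < d ^+ 2 / 2 by rewrite divr_gt0// exprn_gt0.
have [N _ eN] := cvgr_lt _ e0 _ d20.
exists (u N); exists N => // n /= Nn.
rewrite /ball /= -(@ltr_pXn2r _ 2)// ?nnegrE// ?ltW//.
rewrite real_normK ?num_real//; apply: le_lt_trans (ue _ _) _.
have := eN N (leqnn _); have := eN n Nn; rewrite /=; lra.
Qed.

Lemma sqr_dist_lim u e l n : (forall p, (u n - u p) ^+ 2 <= e n + e p) ->
  e p @[p --> \oo] --> (0 : R) -> u p @[p --> \oo] --> l ->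
  (u n - l) ^+ 2 <= e n.
Proof.
move=> ue e0 ul.
apply: (@ler_cvg_to _ (\oo : set_system nat) _ R
  (fun p => (u n - u p) ^+ 2) (fun p => e n + e p)).
- rewrite expr2; have c : u n - u p @[p --> \oo] --> u n - l.
    by apply: cvgB => //; exact: cvg_cst.
  exact: cvgM.
- by rewrite -[X in _ --> X]addr0; apply: cvgD => //; exact: cvg_cst.
- exact: nearW.
Qed.

End real_sequences.

Section indicator_integral.
Context d (T : measurableType d) (R : realType) (mu : probability T R).
Local Notation E f := (Rintegral mu [set: T] f).

Lemma expect_sqr_indic (f : T -> R) A : bmeas f -> measurable A ->
  (E (fun x => f x * \1_A x)) ^+ 2 <= E (fun x => f x ^+ 2).
Proof.
move=> bf mA; apply: le_trans (expect_sqr _ _) _; first by bm.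
apply: le_expect => [||x]; [by bm|by bm|].
rewrite indicE; case: (_ \in _); rewrite ?mulr1// mulr0 expr0n.
exact: sqr_ge0.
Qed.

Lemma expect_indicU (f : T -> R) A B :
  bmeas f -> measurable A -> measurable B ->
  A `&` B = set0 -> E (fun x => f x * \1_(A `|` B) x) =
  E (fun x => f x * \1_A x) + E (fun x => f x * \1_B x).
Proof.
move=> bf mA mB AB; rewrite -expectD; [|by bm..].
apply: eq_Rintegral => x _; rewrite -mulrDr !indicE in_setU; congr (_ * _).
case: (boolP (x \in A)) => Ax; case: (boolP (x \in B)) => Bx;
  rewrite ?addr0 ?add0r//.
suff : set0 x by [].
by rewrite -AB; split; exact: set_mem.
Qed.

Lemma expect_indic_le (f : T -> R) A : bmeas f -> measurable A ->
  (forall x, `|f x| <= 1) -> `|E (fun x => f x * \1_A x)| <= fine (mu A).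
Proof.
move=> bf mA f1; rewrite -expect_indic// ler_norml; apply/andP; split.
  rewrite -mulN1r -expectZ; last by bm.
  apply: le_expect => [||x]; [by bm|by bm|].
  have := f1 x; rewrite ler_norml => /andP[? ?].
  by apply: ler_wpM2r => //; rewrite indicE.
apply: le_expect => [||x]; [by bm|by bm|].
have := f1 x; rewrite ler_norml => /andP[? ?].
by apply: ler_piMl => //; rewrite indicE.
Qed.

End indicator_integral.

Section extreme_averages.
Context (R : realType) (G : topologicalGroupType) (X : ptopologicalType).
Context (act : G -> X -> X).
Hypothesis (cX : compact [set: X]) (hX : hausdorff_space X).
Hypothesis (actP : continuous_action act).
Implicit Types (f k l : X -> R) (mu nu : probability (borelType X) R).
Local Notation E mu f := (Rintegral mu [set: borelType X] f).

(** The Cauchy condition, uniform over Borel sets, makes the signed measures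
    [h n dnu] converge to some [eta], which almost invariance turns into an
    invariant one. As [eta] vanishes by rigidity, the integrals of [h n] over
    all Borel sets are at most [sqrt (e n)], in particular the one over
    [h n > 0], which is half the L1 norm of [h n]. *)
Lemma extreme_almost_invariant_vanish nu
    (h : nat -> borelType X -> R) (e : nat -> R) :
  extreme_points (invariant_measures R act) nu ->
  (forall n, bmeas (h n)) -> (forall n x, `|h n x| <= 1) ->
  (forall n, E nu (h n) = 0) ->
  (forall n p, E nu (fun x => (h n x - h p x) ^+ 2) <= e n + e p) ->
  (forall n g, E nu (fun x => (h n (act g x) - h n x) ^+ 2) <= e n) ->
  e n @[n --> \oo] --> (0 : R) ->
  forall n (d : R), 0 <= d -> e n <= d ^+ 2 ->
  E nu (fun x => h n x ^+ 2) <= 2 * d.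
Proof.
move=> extnu bh h1 h0 he hg e0 n d d0 ed.
have inu : invariant_measure act nu by case: extnu => -[].
pose b (A : set (borelType X)) p := E nu (fun x => h p x * \1_A x).
have bC (A : set (borelType X)) i j : measurable A ->
    (b A i - b A j) ^+ 2 <= e i + e j.
  move=> mA; rewrite /b -expectB; [|by bm..].
  rewrite (_ : (fun x => _) = (fun x => (h i x - h j x) * \1_A x)); last first.
    by apply/funext => x; rewrite mulrBl.
  by apply: le_trans (expect_sqr_indic _ _ _) (he i j) => //; bm.
have bcvg (A : set (borelType X)) : measurable A ->
    b A p @[p --> \oo] --> lim (b A p @[p --> \oo]).
  by move=> mA; apply: (@cvg_of_sqr_dist _ _ e) => // i j; exact: bC.
pose eta (A : set (borelType X)) := lim (b A p @[p --> \oo]).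
have eta0 : forall A : set (borelType X), measurable A -> eta A = 0.
  apply: (extreme_rigid hX actP extnu).
  - move=> A B mA mB AB; apply: cvg_lim => //.
    rewrite (_ : b (A `|` B) = (fun p => b A p + b B p)).
      by apply: cvgD; exact: bcvg.
    by apply/funext => p; exact: expect_indicU.
  - move=> A mA; apply: (@ler_cvg_to _ (\oo : set_system nat) _ R
      (fun p => `|b A p|) (fun=> fine (nu A))).
    + by apply: cvg_norm; exact: bcvg.
    + exact: cvg_cst.
    + by apply: nearW => p; exact: expect_indic_le.
  - rewrite /eta (_ : b setT = (fun=> 0)) ?lim_cst//; apply/funext => p.
    rewrite /b -[RHS](h0 p); apply: eq_Rintegral => x _.
    by rewrite indicE in_setT mulr1.
  - move=> g A mA; apply/eqP; rewrite -subr_eq0 -sqrf_eq0 eq_le sqr_ge0 andbT.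
    have mgA : measurable (act g @^-1` A : set (borelType X)).
      rewrite -[X in measurable X]setTI.
      apply: continuous_self_measurable => //; exact: action_continuous.
    apply: (@ler_cvg_to _ (\oo : set_system nat) _ R
      (fun p => (b (act g @^-1` A) p - b A p) ^+ 2) e) => //.
      rewrite expr2.
      have c : b (act g @^-1` A) p - b A p @[p --> \oo] -->
          eta (act g @^-1` A) - eta A.
        by apply: cvgB; exact: bcvg.
      exact: cvgM.
    apply: nearW => p.
    have bg : bmeas (fun x : borelType X => h p (act g x)).
      exact: (bmeas_act actP g (bh p)).
    have bA : bmeas (fun x => h p x * \1_A x) by bm.
    have bgA : bmeas (\1_(act g @^-1` A : set (borelType X)) :
      borelType X -> R) by bm.
    rewrite {2}/b -(expect_act actP g inu bA) -sqrrN opprB.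
    rewrite /b -expectB; [|exact: (bmeasM bg bgA)|by bm].
    rewrite (_ : (fun x => _) = (fun x : borelType X =>
      (h p (act g x) - h p x) * \1_(act g @^-1` A) x)); last first.
      by apply/funext => x /=; rewrite mulrBl.
    by apply: le_trans (expect_sqr_indic _ _ _) (hg p g) => //; bm.
have bd (A : set (borelType X)) : measurable A -> b A n <= d.
  move=> mA; apply: le_trans (ler_norm _) _.
  rewrite -(@ler_pXn2r _ 2)// ?nnegrE// real_normK ?num_real//.
  apply: le_trans ed; rewrite -[b A n]subr0 -(eta0 A mA).
  by apply: sqr_dist_lim => // [p|]; [exact: bC | exact: bcvg].
pose A := [set x : borelType X | 0 < h n x].
have mA : measurable A.
  case: (bh n) => mh _.
  rewrite (_ : A = h n @^-1` `]0, +oo[); last first.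
    by apply/seteqP; split => x /=; rewrite in_itv /= andbT.
  by rewrite -[X in measurable X]setTI; apply: mh.
apply: (@le_trans _ _ (2 * b A n)); last by rewrite ler_pM2l// bd.
(* On the left h^2 <= |h|, and |h| = 2 h 1_{h > 0} - h has integral 2 b. *)
rewrite -[leRHS]subr0 -(h0 n) /b -expectZ; last by bm.
rewrite -expectB; [|by bm..].
apply: le_expect => [||x]; [by bm|by bm|].
rewrite indicE; have := h1 n x; rewrite ler_norml => /andP[? ?].
case: (boolP (x \in A)) => [/set_mem|/negP hx] /=; first by rewrite /A /=; nra.
have : h n x <= 0.
  by rewrite leNgt; apply/negP => hx'; apply: hx; exact: mem_set.
by nra.
Qed.

Lemma extreme_averages nu : extreme_points (invariant_measures R act) nu ->
  averages_to_constants act nu.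
Proof.
move=> extnu f cf eps eps0.
have inu : invariant_measure act nu by case: extnu => -[].
have [_ [M fM]] := continuous_bmeas cX cf.
set c := E nu f.
have [k_ k_P] : {k_ : nat -> X -> R & forall n, orbit_hull act f (k_ n) /\
    E nu (fun x => k_ n x ^+ 2) <= min_square act nu f + harmonic n}.
  apply: (@choice _ _ (fun n k => orbit_hull act f k /\
    E nu (fun x => k x ^+ 2) <= min_square act nu f + harmonic n)) => n.
  have [k fk ke] :=
    @min_square_approx _ _ _ act nu f (harmonic n) (harmonic_gt0 n).
  by exists k.
have bk n : bmeas (k_ n : borelType X -> R).
  by have [fk _] := k_P n; exact: orbit_hull_bmeas fk.
(* Rescaling brings the recentred averages k_n - c into [-1, 1]. *)
pose B := M + `|c| + 1.
have M0 : 0 <= M by apply: le_trans (fM point); exact: normr_ge0.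
have B0 : 0 < B by rewrite /B; have := normr_ge0 c; lra.
pose s := B^-1; have s0 : 0 < s by rewrite invr_gt0.
pose h n (x : borelType X) := s * (k_ n x - c).
pose e n : R := 4 * s ^+ 2 * harmonic n.
have e0 : e n @[n --> \oo] --> (0 : R).
  rewrite -[X in _ --> X](mulr0 (4 * s ^+ 2)).
  by apply: cvgMr; exact: cvg_harmonic.
have d0 : 0 < s ^+ 2 * eps / 2 by rewrite divr_gt0// mulr_gt0// exprn_gt0.
have [n _ en] : \forall n \near \oo, e n < (s ^+ 2 * eps / 2) ^+ 2.
  by apply: cvgr_lt e0 _ _; rewrite exprn_gt0.
have hE2 (u : borelType X -> R) : bmeas u ->
    E nu (fun x => (s * u x) ^+ 2) = s ^+ 2 * E nu (fun x => u x ^+ 2).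
  move=> bu; rewrite -expectZ; last by bm.
  by apply: eq_Rintegral => x _; rewrite exprMn.
have bh i : bmeas (h i) by rewrite /h; bm.
have := @extreme_almost_invariant_vanish nu h e extnu bh _ _ _ _ e0 n _
  (ltW d0) (ltW (en n (leqnn _))).
have -> : E nu (fun x => h n x ^+ 2) =
    s ^+ 2 * E nu (fun x => (k_ n x - c) ^+ 2).
  by apply: (hE2 (fun x => k_ n x - c)); bm.
rewrite (_ : 2 * (s ^+ 2 * eps / 2) = s ^+ 2 * eps); last by field.
rewrite ler_pM2l ?exprn_gt0// => concl.
exists (k_ n); first by case: (k_P n).
apply: concl.
- move=> i x; rewrite /h normrM gtr0_norm// /s mulrC ler_pdivrMr// mul1r.
  apply: le_trans (ler_normB _ _) _.
  have [fk _] := k_P i; have := orbit_hull_bounded fM fk x; rewrite /B; lra.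
- move=> i; have [fk _] := k_P i; rewrite /h expectZ; last by bm.
  rewrite expectB; [|by bm..].
  by rewrite expect_cst (orbit_hull_expect cX actP inu cf fk) subrr mulr0.
- move=> i j; have [fi ki] := k_P i; have [fj kj] := k_P j.
  rewrite (_ : (fun x => _) =
    (fun x => (s * (k_ i x - k_ j x)) ^+ 2)); last first.
    by apply/funext => x; rewrite /h; congr (_ ^+ 2); ring.
  rewrite hE2; last by bm.
  have := min_square_dist cX actP cf fi fj ki kj.
  rewrite -(ler_pM2l (exprn_gt0 2 s0)) => /le_trans; apply.
  have hs r : 0 < s ^+ 2 * harmonic r.
    by rewrite mulr_gt0 ?exprn_gt0 ?harmonic_gt0.
  by rewrite /e; have := hs i; have := hs j; lra.
- move=> i g; have [fi ki] := k_P i.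
  rewrite (_ : (fun x => _) =
    (fun x : borelType X => (s * (k_ i (act g x) - k_ i x)) ^+ 2)); last first.
    by apply/funext => x; rewrite /h; congr (_ ^+ 2); ring.
  rewrite (hE2 (fun x : borelType X => k_ i (act g x) - k_ i x)); last first.
    by apply: bmeasB => //; exact: (bmeas_act actP g (bk i)).
  have := min_square_shift cX actP g inu cf fi ki.
  rewrite -(ler_pM2l (exprn_gt0 2 s0)) => /le_trans; apply.
  by rewrite /e mulrA (mulrC _ 4).
Qed.

End extreme_averages.

(** * Passing to the limit *)

Section weak_star_limits.
Context (R : realType) (X : ptopologicalType).
Local Notation E mu f := (Rintegral mu [set: borelType X] f).

Lemma weak_star_near (mu : weak_star R X) (f : X -> R) (e : R) :
  continuous f -> 0 < e ->
  \forall nu \near mu, `|E (nu : probability (borelType X) R) f -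
                         E (mu : probability (borelType X) R) f| < e.
Proof.
move=> cf e0.
pose F : continuousType X R := HB.pack f (isContinuous.Build _ _ f cf).
have ci : continuous (@integral_functional R X : weak_star R X -> _).
  exact: initial_continuous.
have cev : {for integral_functional mu,
    continuous (fun phi : {ptws continuousType X R -> R} => phi F)}.
  exact: (@proj_continuous (continuousType X R) (fun=> R) F).
have := continuous_comp (ci mu) cev => /cvgrPdist_lt/(_ e e0).
by apply: filterS => nu; rewrite distrC.
Qed.

End weak_star_limits.

Section limits.
Context (R : realType) (G : topologicalGroupType) (X : ptopologicalType).
Context (act : G -> X -> X).
Hypothesis (cX : compact [set: X]) (actP : continuous_action act).
Implicit Types (f k l : X -> R) (mu nu : probability (borelType X) R).
Local Notation E mu f := (Rintegral mu [set: borelType X] f).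

(** Continuity of the action at [(1, x)] is uniform in [x] by compactness. *)
Lemma almost_fixing_nbhs f (e : R) : continuous f -> 0 < e ->
  exists V : set G, open_nbhs 1%g V /\
    forall v x, V v -> `|f (act v x) - f x| <= e.
Proof.
move=> cf e0; case: (actP) => a1 _ ca.
have cover := (compact_near_coveringP [set: X]).1 cX G (nbhs (1%g : G))
  (fun g x => `|f (act g x) - f x| <= e) _.
have : nbhs (1%g : G)
    [set g | [set: X] `<=` (fun x => `|f (act g x) - f x| <= e)].
  apply: cover => x _.
  have c1 : f (act q.2 q.1) - f q.1 @[q --> (x, 1%g : G)] -->
      f (act 1%g x) - f x.
    apply: cvgB; last by apply: (cvg_comp fst f); [exact: cvg_fst | exact: cf].
    apply: (@cvg_comp _ _ _ (fun q : X * G => (q.2, q.1))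
      (fun p : G * X => f (act p.1 p.2)) _ (nbhs (1%g : G, x))).
      by apply: cvg_pair; [exact: cvg_snd | exact: cvg_fst].
    by apply: (continuous_comp (ca (1%g, x))); exact: cf.
  move/cvgrPdist_le : c1 => /(_ e e0).
  by apply: filterS => -[y g] /=; rewrite a1 subrr sub0r normrN.
by rewrite nbhsE => -[V oV Vsub]; exists V; split=> // v x /Vsub; apply.
Qed.

(** For [g = v h w], the displacement [f \o g - f] telescopes into the
    displacements by [v], [h] and [w], precomposed with measure-preserving maps;
    those by [v] and [w] are small in sup norm. *)
Lemma displacement_double_coset mu f (V A : set G) (a b : R) :
  invariant_measure act mu -> continuous f ->
  [set: G] = mulset (mulset V A) V -> 0 <= a ->
  (forall v x, V v -> (f (act v x) - f x) ^+ 2 <= a) ->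
  (forall g, A g -> E mu (fun x => (f (act g x) - f x) ^+ 2) <= b) ->
  forall g, E mu (fun x => (f (act g x) - f x) ^+ 2) <= 6 * a + 3 * b.
Proof.
move=> imu cf GVAV a0 Vf Af g.
have bf : bmeas (f : borelType X -> R) by exact: continuous_bmeas.
have : [set: G] g by [].
rewrite GVAV => -[_ [v Vv [h Ah <-]]] [w Vw] <-.
pose d (x : borelType X) := (f (act h x) - f x) ^+ 2.
have bd : bmeas d.
  by apply: bmeasX2; apply: bmeasB => //; exact: (bmeas_act actP h bf).
have bdw : bmeas (fun x : borelType X => d (act w x)).
  exact: (bmeas_act actP w bd).
apply: (@le_trans _ _ (E mu (fun x : borelType X => 3 * d (act w x) + 6 * a))).
  apply: le_expect => [||x]; last 1 first.
  - case: (actP) => _ aM _; rewrite !aM.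
    have := Vf v (act h (act w x)) Vv; have := Vf w x Vw; rewrite /d.
    set p := f (act v _); set q := f (act h _); set r := f (act w x).
    have := sqr_ge0 (p - q - (q - r)); have := sqr_ge0 (p - q - (r - f x)).
    have := sqr_ge0 (q - r - (r - f x)); nra.
  - apply: bmeasX2; apply: bmeasB => //.
    exact: (bmeas_act actP (v * h * w)%g bf).
  - by bm.
rewrite expectD; [|by bm..].
rewrite expectZ// expect_cst [leRHS]addrC lerD2r ler_pM2l//.
by have /= -> := expect_act actP w imu bd; exact: Af.
Qed.

(** Smallness of the displacement of [k] by a finite set [A] with [G = V A V] is
    a weak* open condition on the measure, yet on invariant measures it bounds
    the displacements by the whole group. *)
Lemma averages_limit (mu : weak_star R X) : roelcke_precompact G ->
  invariant_measures R act mu ->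
  (forall W, nbhs mu W -> exists nu : weak_star R X,
     [/\ W nu, invariant_measures R act nu & averages_to_constants act nu]) ->
  averages_to_constants act (mu : probability (borelType X) R).
Proof.
move=> rpG [_ imu] muW f cf eps eps0.
pose m : probability (borelType X) R := mu.
rewrite -/m; set c := E m f.
(* 91 = 90 + 1: the bound 90 e found for nu, plus the weak* error e. *)
pose e := Num.min 1 (eps / 91).
have e0 : 0 < e by rewrite lt_min ltr01 divr_gt0.
have e1 : e <= 1 by rewrite ge_min lexx.
have eeps : 91 * e <= eps.
  by rewrite mulrC -ler_pdivlMr// /e ge_min lexx orbT.
have [k fk ke] := min_square_approx act m f e0.
have ck := orbit_hull_continuous actP cf fk.
have bk : bmeas (k : borelType X -> R) by exact: continuous_bmeas.
have kg := min_square_shift cX actP _ imu cf fk ke.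
have [V [oV Vk]] := almost_fixing_nbhs ck e0.
have [A finA GVAV] := rpG V oV.
pose d g x := (k (act g x) - k x) ^+ 2.
have csub (u v : X -> R) : continuous u -> continuous v ->
    continuous (fun x => (u x - v x) ^+ 2).
  move=> cu cv x; have c1 : (u y - v y) @[y --> x] --> u x - v x.
    by apply: cvgB; [exact: cu | exact: cv].
  exact: (cvgM c1 c1).
have cd g : continuous (d g).
  apply: csub => // x.
  by apply: continuous_comp; [exact: action_continuous|exact: ck].
have near_d : \forall nu \near mu, forall g, A g ->
    `|E (nu : probability (borelType X) R) (d g) - E m (d g)| < e.
  have /finite_seqP[s ->] := finA.
  elim: s => [|g s ih]; first by apply: (filterE (F := nbhs mu)) => nu g.
  have := weak_star_near mu (cd g) e0; apply: filterS2 ih => nu ihnu gnu h.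
  by rewrite /= in_cons => /predU1P[->|/ihnu].
have near_k := weak_star_near mu ck e0.
have cc : continuous (fun _ : X => c) by move=> x; exact: cvg_cst.
have near_v := weak_star_near mu (csub _ _ ck cc) e0.
have [nu [[[dnu knu] vnu] [_ inu] anu]] :=
  muW _ (filterI (filterI near_d near_k) near_v).
pose n : probability (borelType X) R := nu.
have dn g : A g -> E n (d g) <= 5 * e.
  by move=> Ag; have := dnu g Ag; have := kg g; rewrite ltr_norml /d; lra.
have kn := displacement_double_coset inu ck GVAV (ltW e0) _ dn.
have {}kn g : E n (fun x => (k (act g x) - k x) ^+ 2) <= 21 * e.
  apply: le_trans (kn _ g) _; last by lra.
  move=> v x Vv; have := Vk v x Vv; rewrite ler_norml; nra.
have [l kl le] := anu k ck e e0.
have bl : bmeas (l : borelType X -> R) by exact: orbit_hull_bmeas kl.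
have lk := orbit_hull_dist cX actP ck kn kl.
exists k => //.
have cE : E m k = c by exact: (orbit_hull_expect cX actP imu cf fk).
set cn := E n k in le.
(* Write k - c = (k - l) + (l - cn) + (cn - c); then 4 * 21 + 4 + 2 = 90. *)
have vn : E n (fun x => (k x - c) ^+ 2) <= 90 * e.
  apply: (@le_trans _ _ (E n (fun x => 4 * (l x - k x) ^+ 2 +
      4 * (l x - cn) ^+ 2 + 2 * (cn - c) ^+ 2))).
    apply: le_expect => [||x]; [by bm|by bm|].
    have := sqr_ge0 (l x - k x + (l x - cn)).
    have := sqr_ge0 (k x - cn - (cn - c)); lra.
  rewrite expectD; [|by bm..].
  rewrite expectD; [|by bm..].
  rewrite !expectZ; [|by bm..].
  rewrite expect_cst.
  have : (cn - c) ^+ 2 <= e.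
    move: knu; rewrite -/n -/cn -/m cE ltr_norml; nra.
  lra.
move: vnu; rewrite -/n -/m ltr_norml; lra.
Qed.

End limits.

(** * The extreme points are closed *)

Theorem corollary1p2 (R : realType) (G : topologicalGroupType)
  (X : ptopologicalType) (act : G -> X -> X) :
  non_archimedean G -> roelcke_precompact G -> polish R G ->
  compact [set: X] -> hausdorff_space X -> continuous_action act ->
  closed (extreme_points (invariant_measures R act) :
            set (subspace (invariant_measures R act))).
Proof.
move=> _ rpG _ cX hX actP mu clmu.
have [Kmu|nKmu] := pselect (invariant_measures R act mu); last first.
  (* Points outside the subspace are isolated. *)
  have : nbhs (mu : subspace (invariant_measures R act)) [set mu].
    case: (@nbhs_subspaceP (weak_star R X) (invariant_measures R act) mu) => //.
    by move=> _ _ ->.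
  by move=> /clmu[nu [extnu <-]].
apply: averaging_extreme => //.
apply: (averages_limit cX actP rpG Kmu) => W muW.
have : nbhs (mu : subspace (invariant_measures R act)) W.
  case: (@nbhs_subspaceP (weak_star R X) (invariant_measures R act) mu) => // _.
  by move: muW; apply: filterS => nu Wnu _.
move=> /clmu[nu [extnu Wnu]]; exists nu; split=> //; first by case: extnu.
exact: (extreme_averages cX hX actP).
Qed.
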